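(* Let $p,q$ be coprime positive integers and let $r\ge 1$ be an integer. For any $\beta\in\mathbb{C}$ which is not an integer divisible by $r$ we have \[\int_0^1 e^{\pi i\beta x}s_{p,q;r}(x)\,dx=\frac{2e^{\pi i\beta/2}\sin\frac{\pi\beta}{2}}{\pi\beta}\,n_{p,q;r}\!\left(\frac{\pi\beta}{2}\right),\] where \[n_{p,q;r}(t)=\cot\frac{t}{pqr}\cot\frac{t}{r}-\cot\frac{t}{pr}\cot\frac{t}{qr}.\]
   Context: For coprime positive integers $p,q$ let \[\Sigma_{p,q}=\left\{\frac{k}{p}+\frac{l}{q}\colon k,l\in\mathbb{Z},\ 1\le k<p,\ 1\le l<q\right\}\subset[0,2]\cap\mathbb{Q},\] and for $x\in[0,1]$ let $s_{p,q}(x)=-2\,\#\bigl(\Sigma_{p,q}\cap(x,x+1)\bigr)+\#\Sigma_{p,q}$. For an integer $r\ge1$ and $x\in[0,1]$ put $s_{p,q;r}(x)=s_{p,q}(\{rx\})$, where $\{y\}=y-\lfloor y\rfloor$ is the fractional part of $y$ (so $s_{p,q;1}=s_{p,q}$ on $[0,1)$). *)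

(* Defs.v *)
From Stdlib Require Import Reals ZArith Znumtheory List Permutation ClassicalEpsilon.
From Coquelicot Require Import Coquelicot.

Open Scope R_scope.

(* Coquelicot has no complex elementary functions. *)
Definition Cexp (z : C) : C :=
  (RtoC (exp (Re z)) * (RtoC (cos (Im z)) + Ci * RtoC (sin (Im z))))%C.
Definition Csin (z : C) : C :=
  ((Cexp (Ci * z) - Cexp (- (Ci * z))) / (RtoC 2 * Ci))%C.
Definition Ccos (z : C) : C :=
  ((Cexp (Ci * z) + Cexp (- (Ci * z))) / RtoC 2)%C.
Definition Ccot (z : C) : C := (Ccos z / Csin z)%C.

Definition is_card (A : R -> Prop) (n : nat) : Prop :=
  exists l : list R, NoDup l /\ (forall y, In y l <-> A y) /\ length l = n.

(* Unspecified when A is infinite; it is only applied to finite sets below. *)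
Definition card (A : R -> Prop) : nat := epsilon (inhabits 0%nat) (is_card A).

Lemma card_eq (A : R -> Prop) (n : nat) : is_card A n -> card A = n.
Proof.
intros H.
assert (H' : is_card A (card A))
  by exact (epsilon_spec _ _ (ex_intro _ n H)).
destruct H as [l [Nl [Al El]]], H' as [m [Nm [Am Em]]].
rewrite <- El, <- Em.
apply Permutation_length, NoDup_Permutation; auto.
intros y; rewrite Al, Am; tauto.
Qed.

Definition Sigma (p q : Z) (y : R) : Prop :=
  exists k l : Z, (1 <= k < p)%Z /\ (1 <= l < q)%Z /\
    y = IZR k / IZR p + IZR l / IZR q.

Definition s (p q : Z) (x : R) : Z :=
  (-2 * Z.of_nat (card (fun y => Sigma p q y /\ (x < y < x + 1)%R))
   + Z.of_nat (card (Sigma p q)))%Z.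

Definition s_r (p q r : Z) (x : R) : Z := s p q (frac_part (IZR r * x)).

Definition n_r (p q r : Z) (t : C) : C :=
  (Ccot (t / RtoC (IZR (p * q * r))) * Ccot (t / RtoC (IZR r))
   - Ccot (t / RtoC (IZR (p * r))) * Ccot (t / RtoC (IZR (q * r))))%C.

(* Main.v *)
Require Import Defs.
From Stdlib Require Import Reals ZArith Znumtheory List Permutation FinFun Lra Lia.
From Coquelicot Require Import Coquelicot.

(* On [(0, 1)] the function [s] is a sum of one step function for each point
   [sigma = (k q + l p) / (p q)] of [Sigma], so the integral for [r = 1] is a finite sum of
   powers of [u = exp (c / (p q))], the points [sigma > 1] being moved back by [1].  Let [L] and
   [H] be the sums of the powers over the points below and above [1], with [k = 0] and [l = 0]
   allowed.  Then [L + H] is the geometric series [1 + u + ... + u^(p q - 1)] by the Chinese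
   remainder theorem, while [L + u^(p q) H] is a product of two geometric series; solving for
   [L] and [H] gives the cotangents.  For general [r] the integral splits into [r] translates
   of the case [r = 1], which contribute one more geometric series. *)

(** * The complex exponential and the cotangent *)

Lemma Cexp_0 : Cexp 0 = 1.
Proof.
unfold Cexp; simpl; rewrite exp_0, cos_0, sin_0; ring.
Qed.

Lemma Cexp_plus (z w : C) : Cexp (z + w) = (Cexp z * Cexp w)%C.
Proof.
destruct z as [a b], w as [c d].
unfold Cexp; simpl; rewrite exp_plus, cos_plus, sin_plus.
apply injective_projections; simpl; ring.
Qed.

Lemma Cexp_neq_0 (z : C) : Cexp z <> 0.
Proof.
intros H; apply C1_nz.
rewrite <- Cexp_0.
replace (RtoC 0) with (z + - z)%C by ring.
rewrite Cexp_plus, H; ring.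
Qed.

Lemma Cexp_opp (z : C) : Cexp (- z) = (/ Cexp z)%C.
Proof.
assert (H := Cexp_neq_0 z).
assert (E : (Cexp z * Cexp (- z) = 1)%C).
{ rewrite <- Cexp_plus, <- Cexp_0; f_equal; ring. }
replace (/ Cexp z)%C with (/ Cexp z * (Cexp z * Cexp (- z)))%C by (rewrite E; ring).
field; exact H.
Qed.

Lemma Cexp_pow (z : C) (n : nat) : (Cexp z ^ n)%C = Cexp (RtoC (INR n) * z).
Proof.
induction n as [|n IH].
- simpl; rewrite <- Cexp_0; f_equal; ring.
- rewrite Cpow_S, IH, <- Cexp_plus, S_INR, RtoC_plus; f_equal; ring.
Qed.

Lemma Cexp_eq_1 (z : C) :
  Cexp z = 1 -> exists k : Z, z = (RtoC (2 * IZR k * PI) * Ci)%C.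
Proof.
destruct z as [a b]; unfold Cexp; simpl; intros H.
assert (H1 : exp a * cos b = 1).
{ apply (f_equal fst) in H; simpl in H; lra. }
assert (H2 : exp a * sin b = 0).
{ apply (f_equal snd) in H; simpl in H; lra. }
assert (Ha := exp_pos a).
assert (Hs : sin b = 0) by (apply Rmult_integral in H2; lra).
assert (Hc := sin2_cos2 b); unfold Rsqr in Hc; rewrite Hs in Hc.
assert (Hcb : cos b = 1) by nra.
assert (Hea : exp a = 1) by (rewrite Hcb in H1; lra).
assert (Ha0 : a = 0) by (apply exp_inv; rewrite exp_0; exact Hea).
(* From [sin b = 0] alone [b] is only a multiple of [PI]; the identity [cos b = 1 - 2 sin^2 (b / 2)]
   makes [b / 2] one as well. *)
assert (Hb : sin (b / 2) = 0).
{ assert (D := cos_2a_sin (b / 2)).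
  replace (2 * (b / 2)) with b in D by field; nra. }
apply sin_eq_0_0 in Hb; destruct Hb as [k Hk].
exists k; subst a; apply injective_projections; simpl; lra.
Qed.

(** This turns the cotangents of [n_r] into rational functions of powers of one exponential; the
    hypothesis keeps [z] away from the zeros of the sine. *)
Lemma Ccot_Cexp (z : C) :
  Cexp (2 * Ci * z) <> 1 ->
  Ccot z = (Ci * (Cexp (2 * Ci * z) + 1) / (Cexp (2 * Ci * z) - 1))%C.
Proof.
unfold Ccot, Ccos, Csin; intros H.
replace (2 * Ci * z)%C with (Ci * z + Ci * z)%C in * by ring.
rewrite Cexp_plus in *; rewrite Cexp_opp.
assert (He := Cexp_neq_0 (Ci * z)).
set (e := Cexp (Ci * z)) in *.
assert (Hd : (e * e - 1)%C <> 0) by (apply Cminus_eq_contra; exact H).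
assert (Hi := Ci_nz).
assert (H2 : RtoC 2 <> 0) by (intros E; apply (f_equal fst) in E; simpl in E; lra).
field; repeat split; auto.
Qed.

(** * Finite sums of complex numbers *)

Definition Csum {A : Type} (l : list A) (f : A -> C) : C :=
  fold_right (fun a z => (f a + z)%C) (RtoC 0) l.

Lemma Csum_ext_in {A : Type} (l : list A) (f g : A -> C) :
  (forall a, In a l -> f a = g a) -> Csum l f = Csum l g.
Proof.
induction l as [|a l IH]; simpl; intros H; auto.
rewrite H, IH; auto.
Qed.

Lemma Csum_plus {A : Type} (l : list A) (f g : A -> C) :
  Csum l (fun a => (f a + g a)%C) = (Csum l f + Csum l g)%C.
Proof. induction l as [|a l IH]; simpl; [|rewrite IH]; ring. Qed.

Lemma Csum_mult_l {A : Type} (l : list A) (c : C) (f : A -> C) :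
  Csum l (fun a => (c * f a)%C) = (c * Csum l f)%C.
Proof. induction l as [|a l IH]; simpl; [|rewrite IH]; ring. Qed.

Lemma Csum_app {A : Type} (l m : list A) (f : A -> C) :
  Csum (l ++ m) f = (Csum l f + Csum m f)%C.
Proof. induction l as [|a l IH]; simpl; [|rewrite IH]; ring. Qed.

Lemma Csum_map {A B : Type} (h : A -> B) (l : list A) (f : B -> C) :
  Csum (map h l) f = Csum l (fun a => f (h a)).
Proof. induction l as [|a l IH]; simpl; [|rewrite IH]; reflexivity. Qed.

Lemma Csum_Permutation {A : Type} (l m : list A) (f : A -> C) :
  Permutation l m -> Csum l f = Csum m f.
Proof. induction 1; simpl; try congruence; ring. Qed.

Lemma Csum_list_prod {A B : Type} (l : list A) (m : list B) (f : A * B -> C) :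
  Csum (list_prod l m) f = Csum l (fun a => Csum m (fun b => f (a, b))).
Proof.
induction l as [|a l IH]; simpl; auto.
rewrite Csum_app, Csum_map, IH; reflexivity.
Qed.

(** Stated without division, so that it also holds at [u = 1]. *)
Lemma Csum_geometric (u : C) (n : nat) :
  ((u - 1) * Csum (seq 0 n) (Cpow u) = u ^ n - 1)%C.
Proof.
induction n as [|n IH]; [simpl; ring|].
rewrite seq_S, Csum_app, Cmult_plus_distr_l, IH, Cpow_S; simpl; ring.
Qed.

(** * Index boxes and residues modulo [p q] *)

Lemma NoDup_list_prod {A B : Type} (l : list A) (m : list B) :
  NoDup l -> NoDup m -> NoDup (list_prod l m).
Proof.
intros Hl Hm; induction Hl as [|a l Ha Hl IH]; simpl; [constructor|].
apply NoDup_app; auto.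
- apply Injective_map_NoDup; auto; intros b b' E; congruence.
- intros [a' b] H1 H2; apply in_map_iff in H1; destruct H1 as [b' [E _]].
  apply in_prod_iff in H2; destruct H2 as [H2 _]; congruence.
Qed.

(** The numerator of [k / p + l / q] over [p q]: comparing a point with 1 becomes comparing naturals
    with [p * q]. *)
Definition numer (p q : nat) (kl : nat * nat) : nat := (fst kl * q + snd kl * p)%nat.

Definition box (p q : nat) : list (nat * nat) := list_prod (seq 0 p) (seq 0 q).

(** The index set of [Sigma]; [box] adds the axes [k = 0] and [l = 0], which complete the residue
    systems modulo [p] and [q]. *)
Definition inner_box (p q : nat) : list (nat * nat) :=
  list_prod (seq 1 (p - 1)) (seq 1 (q - 1)).

Lemma in_box (p q : nat) (kl : nat * nat) :
  In kl (box p q) <-> (fst kl < p /\ snd kl < q)%nat.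
Proof.
destruct kl; unfold box; rewrite in_prod_iff, !in_seq; simpl; lia.
Qed.

Lemma in_inner_box (p q : nat) (kl : nat * nat) :
  In kl (inner_box p q) <-> (1 <= fst kl < p /\ 1 <= snd kl < q)%nat.
Proof.
destruct kl; unfold inner_box; rewrite in_prod_iff, !in_seq; simpl; lia.
Qed.

Lemma NoDup_box (p q : nat) : NoDup (box p q).
Proof. apply NoDup_list_prod; apply seq_NoDup. Qed.

Lemma NoDup_inner_box (p q : nat) : NoDup (inner_box p q).
Proof. apply NoDup_list_prod; apply seq_NoDup. Qed.

Lemma Zdivide_small_eq (p a b : Z) :
  (0 <= a < p -> 0 <= b < p -> (p | a - b) -> a = b)%Z.
Proof. intros Ha Hb [d Hd]; assert (d = 0)%Z by nia; nia. Qed.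

(** Modulo [p] the numerator is [k q] with [q] invertible, which determines [k]; modulo [q] it
    determines [l] in the same way. *)
Lemma numer_inj_mod (p q : nat) (kl kl' : nat * nat) :
  rel_prime (Z.of_nat p) (Z.of_nat q) ->
  In kl (box p q) -> In kl' (box p q) ->
  (Z.of_nat (p * q) | Z.of_nat (numer p q kl) - Z.of_nat (numer p q kl'))%Z ->
  kl = kl'.
Proof.
destruct kl as [k l], kl' as [k' l'].
rewrite !in_box; unfold numer; simpl; intros Hc H H' [d Hd].
f_equal; apply Nat2Z.inj.
- apply (Zdivide_small_eq (Z.of_nat p)); [lia|lia|].
  apply Gauss with (Z.of_nat q); auto.
  exists (Z.of_nat q * d - Z.of_nat l + Z.of_nat l')%Z; nia.
- apply (Zdivide_small_eq (Z.of_nat q)); [lia|lia|].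
  apply Gauss with (Z.of_nat p); [|apply rel_prime_sym; exact Hc].
  exists (Z.of_nat p * d - Z.of_nat k + Z.of_nat k')%Z; nia.
Qed.

(** An injection of [p q] pairs into [p q] residues is a bijection. *)
Lemma numer_mod_Permutation (p q : nat) :
  (0 < p)%nat -> (0 < q)%nat -> rel_prime (Z.of_nat p) (Z.of_nat q) ->
  Permutation (map (fun kl => numer p q kl mod (p * q))%nat (box p q))
    (seq 0 (p * q)).
Proof.
intros Hp Hq Hc.
apply NoDup_Permutation_bis.
- apply Injective_map_NoDup_in; [|apply NoDup_box].
  intros kl kl' H H' E; apply (numer_inj_mod p q); auto.
  assert (D := Nat.div_mod_eq (numer p q kl) (p * q)).
  assert (D' := Nat.div_mod_eq (numer p q kl') (p * q)).
  exists (Z.of_nat (numer p q kl / (p * q)) - Z.of_nat (numer p q kl' / (p * q)))%Z.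
  nia.
- rewrite length_map; unfold box; rewrite length_prod, !length_seq; lia.
- intros n H; apply in_map_iff in H; destruct H as [kl [<- _]].
  apply in_seq; split; [lia|]; apply Nat.mod_upper_bound; nia.
Qed.

(** The value [p q] is congruent to the numerator of [(0, 0)], which is not an inner pair. Hence 1
    is not in [Sigma]. *)
Lemma numer_neq (p q : nat) (kl : nat * nat) :
  rel_prime (Z.of_nat p) (Z.of_nat q) ->
  In kl (inner_box p q) -> numer p q kl <> (p * q)%nat.
Proof.
intros Hc; rewrite in_inner_box; intros H E.
assert (D : kl = (0%nat, 0%nat)).
{ apply (numer_inj_mod p q); auto; try (rewrite in_box; simpl; lia).
  exists 1%Z; rewrite E; change (numer p q (0, 0)%nat) with 0%nat; lia. }
subst kl; simpl in H; lia.
Qed.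

(** * Power sums over the points on either side of 1 *)

Definition side (p q : nat) (kl : nat * nat) : C :=
  if (numer p q kl <? p * q)%nat then RtoC 1 else (- RtoC 1)%C.

(* The reflection [(k, l) -> (p - k, q - l)] exchanges the two sides. *)
Lemma Csum_side (p q : nat) :
  rel_prime (Z.of_nat p) (Z.of_nat q) ->
  Csum (inner_box p q) (side p q) = 0.
Proof.
intros Hc.
set (rf := fun kl : nat * nat => (p - fst kl, q - snd kl)%nat).
assert (Hrf : Permutation (map rf (inner_box p q)) (inner_box p q)).
{ apply Permutation_map_same_l.
  - apply Injective_map_NoDup_in; [|apply NoDup_inner_box].
    intros [k l] [k' l']; rewrite !in_inner_box; simpl; intros H H' E.
    injection E; intros; f_equal; lia.
  - intros kl H; apply in_map_iff in H; destruct H as [[k l] [<- H]].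
    rewrite in_inner_box in *; simpl in *; lia. }
assert (E : Csum (inner_box p q) (side p q)
            = (- (1) * Csum (inner_box p q) (side p q))%C).
{ rewrite <- (Csum_Permutation _ _ _ Hrf) at 1.
  rewrite Csum_map, <- Csum_mult_l; apply Csum_ext_in; intros kl H.
  assert (Hn := numer_neq p q kl Hc H).
  rewrite in_inner_box in H.
  (* Since neither numerator equals [p q], exactly one of the two lies below it. *)
  assert (Hs : (numer p q (rf kl) + numer p q kl = 2 * (p * q))%nat).
  { unfold numer, rf; simpl; nia. }
  unfold side; destruct (Nat.ltb_spec (numer p q kl) (p * q));
    destruct (Nat.ltb_spec (numer p q (rf kl)) (p * q)); try lia; ring. }
set (S := Csum _ _) in *.
assert (H2 : RtoC 2 <> 0) by (intros H; apply (f_equal fst) in H; simpl in H; lra).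
replace S with (/ 2 * (S + S))%C by (field; auto).
rewrite E at 1; ring.
Qed.

Definition low (u : C) (p q : nat) (kl : nat * nat) : C :=
  if (numer p q kl <? p * q)%nat then (u ^ numer p q kl)%C else RtoC 0.

(** Lowering the exponent by [p q] moves the point back by 1; on [box], where numerators are less
    than [2 p q], it is reduction modulo [p q]. *)
Definition high (u : C) (p q : nat) (kl : nat * nat) : C :=
  if (numer p q kl <? p * q)%nat then RtoC 0 else (u ^ (numer p q kl - p * q))%C.

Lemma low_plus_high (u : C) (p q : nat) (kl : nat * nat) :
  In kl (box p q) ->
  (low u p q kl + high u p q kl = u ^ (numer p q kl mod (p * q)))%C.
Proof.
rewrite in_box; intros H; unfold low, high.
destruct (Nat.ltb_spec (numer p q kl) (p * q)) as [L|L].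
- rewrite Nat.mod_small by exact L; ring.
- replace (numer p q kl mod (p * q))%nat with (numer p q kl - p * q)%nat; [ring|].
  apply Nat.mod_unique with 1%nat; [|lia].
  unfold numer in *; nia.
Qed.

(** The factor [u ^ (p * q)] undoes the shift in [high], leaving the full power [u ^ numer], which
    separates into a factor in [k] and one in [l]. *)
Lemma low_plus_mult_high (u : C) (p q : nat) (kl : nat * nat) :
  (low u p q kl + u ^ (p * q) * high u p q kl
   = (u ^ q) ^ fst kl * (u ^ p) ^ snd kl)%C.
Proof.
rewrite <- !Cpow_mult_r, <- Cpow_add_r; unfold low, high.
replace (q * fst kl + p * snd kl)%nat with (numer p q kl) by (unfold numer; lia).
destruct (Nat.ltb_spec (numer p q kl) (p * q)) as [L|L]; [ring|].
rewrite Cplus_0_l, <- Cpow_add_r; f_equal; lia.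
Qed.

(* By the Chinese remainder theorem [numer] runs over all residues modulo [p * q]. *)
Lemma Csum_low_plus_high (u : C) (p q : nat) :
  (0 < p)%nat -> (0 < q)%nat -> rel_prime (Z.of_nat p) (Z.of_nat q) ->
  ((u - 1) * (Csum (box p q) (low u p q) + Csum (box p q) (high u p q))
   = u ^ (p * q) - 1)%C.
Proof.
intros Hp Hq Hc; rewrite <- Csum_plus.
rewrite (Csum_ext_in _ _ _ (low_plus_high u p q)).
rewrite <- (Csum_map (fun kl => numer p q kl mod (p * q))%nat (box p q) (Cpow u)).
rewrite (Csum_Permutation _ _ _ (numer_mod_Permutation p q Hp Hq Hc)).
apply Csum_geometric.
Qed.

Lemma Csum_low_plus_mult_high (u : C) (p q : nat) :
  ((u ^ p - 1) * (u ^ q - 1)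
   * (Csum (box p q) (low u p q) + u ^ (p * q) * Csum (box p q) (high u p q))
   = (u ^ (p * q) - 1) * (u ^ (p * q) - 1))%C.
Proof.
rewrite <- Csum_mult_l, <- Csum_plus.
rewrite (Csum_ext_in _ _ _ (fun kl _ => low_plus_mult_high u p q kl)).
unfold box; rewrite Csum_list_prod; simpl.
rewrite (Csum_ext_in _ _ (fun k => Csum (seq 0 q) (Cpow (u ^ p)) * (u ^ q) ^ k)%C)
  by (intros k _; rewrite Csum_mult_l; apply Cmult_comm).
rewrite Csum_mult_l.
assert (E := Csum_geometric (u ^ p) q); assert (F := Csum_geometric (u ^ q) p).
rewrite <- Cpow_mult_r in E, F; rewrite Nat.mul_comm in F.
(* One factor [u ^ (p * q) - 1] is expanded as a series in [u ^ p], the other as a series in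
   [u ^ q]. *)
rewrite <- E at 1; rewrite <- F.
generalize (u ^ p)%C (u ^ q)%C; intros P Q.
generalize (Csum (seq 0 q) (Cpow P)) (Csum (seq 0 p) (Cpow Q)).
intros X Y; ring.
Qed.

(** Inclusion-exclusion: the two axes share the corner [(0, 0)]. *)
Lemma Csum_box (p q : nat) (f : nat * nat -> C) :
  (0 < p)%nat -> (0 < q)%nat ->
  Csum (box p q) f
  = (Csum (seq 0 p) (fun k => f (k, 0%nat)) + Csum (seq 0 q) (fun l => f (0%nat, l))
     - f (0%nat, 0%nat) + Csum (inner_box p q) f)%C.
Proof.
intros Hp Hq; destruct p as [|p], q as [|q]; try lia.
unfold box, inner_box; rewrite !Csum_list_prod, !Nat.sub_succ, !Nat.sub_0_r.
simpl; rewrite Csum_plus; ring.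
Qed.

(* [c] times the integral of [exp (c x)] against the step function of the point
   [numer p q kl / (p q)], where [u = exp (c / (p q))]. *)
Definition jump_term (u : C) (p q : nat) (kl : nat * nat) : C :=
  ((u ^ (p * q) + 1) * side p q kl + 2 * (high u p q kl - low u p q kl))%C.

(** The [side] terms cancel, leaving [2 (H - L)] for the inner sums [H] of [high] and [L] of [low].
    The two identities over [box], with the axes removed, form a linear system for [L] and [H] of
    determinant [u ^ (p * q) - 1]. *)
Lemma Csum_jump_term (u : C) (p q : nat) :
  (0 < p)%nat -> (0 < q)%nat -> rel_prime (Z.of_nat p) (Z.of_nat q) ->
  (u ^ (p * q))%C <> 1 ->
  Csum (inner_box p q) (jump_term u p q)
  = ((u ^ (p * q) - 1)
     * ((u ^ p + 1) / (u ^ p - 1) * ((u ^ q + 1) / (u ^ q - 1))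
        - (u + 1) / (u - 1) * ((u ^ (p * q) + 1) / (u ^ (p * q) - 1))))%C.
Proof.
intros Hp Hq Hc HU.
(* [u ^ (p * q)] is a power of each of [u], [u ^ p] and [u ^ q], so none of them can be 1. *)
assert (H1 : (u - 1)%C <> 0).
{ apply Cminus_eq_contra; intros E; apply HU; rewrite E; apply Cpow_1_l. }
assert (HP : (u ^ p - 1)%C <> 0).
{ apply Cminus_eq_contra; intros E; apply HU; rewrite Cpow_mult_r, E; apply Cpow_1_l. }
assert (HQ : (u ^ q - 1)%C <> 0).
{ apply Cminus_eq_contra; intros E; apply HU.
  rewrite Nat.mul_comm, Cpow_mult_r, E; apply Cpow_1_l. }
assert (HU1 : (u ^ (p * q) - 1)%C <> 0) by (apply Cminus_eq_contra; exact HU).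
unfold jump_term; rewrite Csum_plus, !Csum_mult_l, (Csum_side p q Hc).
assert (Hdiff : Csum (inner_box p q) (fun kl => (high u p q kl - low u p q kl)%C)
  = (Csum (inner_box p q) (high u p q) - Csum (inner_box p q) (low u p q))%C).
{ transitivity (Csum (inner_box p q) (fun kl => (high u p q kl + - (1) * low u p q kl)%C)).
  - apply Csum_ext_in; intros; ring.
  - rewrite Csum_plus, Csum_mult_l; ring. }
rewrite Hdiff; clear Hdiff.
assert (E1 := Csum_low_plus_high u p q Hp Hq Hc).
assert (E2 := Csum_low_plus_mult_high u p q).
rewrite !(Csum_box p q) in E1, E2 by auto.
(* Points on the axes lie below 1: there [high] vanishes and [low] gives plain geometric series. *)
assert (N1 : forall k, In k (seq 0 p) -> (numer p q (k, 0) <? p * q)%nat = true).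
{ intros k Hk; apply in_seq in Hk; apply Nat.ltb_lt; unfold numer; simpl; nia. }
assert (N2 : forall l, In l (seq 0 q) -> (numer p q (0, l) <? p * q)%nat = true).
{ intros l Hl; apply in_seq in Hl; apply Nat.ltb_lt; unfold numer; simpl; nia. }
assert (L1 : ((u ^ q - 1) * Csum (seq 0 p) (fun k => low u p q (k, 0%nat)) = u ^ (p * q) - 1)%C).
{ rewrite (Nat.mul_comm p q), Cpow_mult_r, <- (Csum_geometric (u ^ q) p); f_equal.
  apply Csum_ext_in; intros k Hk; unfold low; rewrite N1 by exact Hk.
  rewrite <- Cpow_mult_r; f_equal; unfold numer; simpl; lia. }
assert (L2 : ((u ^ p - 1) * Csum (seq 0 q) (fun l => low u p q (0%nat, l)) = u ^ (p * q) - 1)%C).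
{ rewrite Cpow_mult_r, <- (Csum_geometric (u ^ p) q); f_equal.
  apply Csum_ext_in; intros l Hl; unfold low; rewrite N2 by exact Hl.
  rewrite <- Cpow_mult_r; f_equal; unfold numer; simpl; lia. }
assert (Z0 : forall {A} (l : list A), Csum l (fun _ => RtoC 0) = 0).
{ intros A l; induction l as [|a l IH]; simpl; [|rewrite IH]; ring. }
assert (M1 : Csum (seq 0 p) (fun k => high u p q (k, 0%nat)) = 0).
{ rewrite <- (Z0 _ (seq 0 p)); apply Csum_ext_in; intros k Hk.
  unfold high; rewrite N1 by exact Hk; reflexivity. }
assert (M2 : Csum (seq 0 q) (fun l => high u p q (0%nat, l)) = 0).
{ rewrite <- (Z0 _ (seq 0 q)); apply Csum_ext_in; intros l Hl.
  unfold high; rewrite N2 by exact Hl; reflexivity. }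
assert (M3 : high u p q (0, 0)%nat = 0).
{ unfold high; rewrite N2 by (apply in_seq; lia); reflexivity. }
assert (L3 : low u p q (0, 0)%nat = 1).
{ unfold low; rewrite N2 by (apply in_seq; lia); reflexivity. }
rewrite M1, M2, M3, L3 in E1, E2.
set (L := Csum (inner_box p q) (low u p q)) in *.
set (H := Csum (inner_box p q) (high u p q)) in *.
set (X := Csum (seq 0 p) _) in *; set (Y := Csum (seq 0 q) _) in *.
set (U := (u ^ (p * q))%C) in *; set (P := (u ^ p)%C) in *; set (Q := (u ^ q)%C) in *.
assert (EX : X = ((U - 1) / (Q - 1))%C) by (rewrite <- L1; field; exact HQ).
assert (EY : Y = ((U - 1) / (P - 1))%C) by (rewrite <- L2; field; exact HP).
assert (ES : (L + H = (U - 1) / (u - 1) - X - Y + 1)%C).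
{ rewrite <- E1; field; exact H1. }
assert (ET : (L + U * H = (U - 1) * (U - 1) / ((P - 1) * (Q - 1)) - X - Y + 1)%C).
{ rewrite <- E2; field; auto. }
(* Subtracting the two relations cancels the axis terms [X], [Y] and the corner, and leaves
   [(U - 1) H]. *)
assert (EH : H = ((U - 1) / ((P - 1) * (Q - 1)) - 1 / (u - 1))%C).
{ transitivity (((L + U * H) - (L + H)) / (U - 1))%C; [field; exact HU1|].
  rewrite ET, ES; field; auto. }
assert (EL : L = ((U - 1) / (u - 1) - X - Y + 1 - H)%C) by (rewrite <- ES; ring).
rewrite EL, EH, EX, EY; field; auto.
Qed.

(** * The function [s] as a sum over the points of [Sigma] *)

Definition sigma_pt (p q : nat) (kl : nat * nat) : R :=
  INR (fst kl) / INR p + INR (snd kl) / INR q.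

Lemma sigma_pt_numer (p q : nat) (kl : nat * nat) :
  (0 < p)%nat -> (0 < q)%nat ->
  sigma_pt p q kl = INR (numer p q kl) / INR (p * q).
Proof.
intros Hp Hq; apply lt_0_INR in Hp, Hq.
unfold sigma_pt, numer; rewrite plus_INR, !mult_INR; field; lra.
Qed.

(** Counting pairs counts points because distinct inner pairs have distinct numerators. The
    predicate [A] is left general to cover both cardinalities in [s]. *)
Lemma is_card_Sigma_filter (p q : nat) (A : R -> Prop) (b : nat * nat -> bool) :
  (0 < p)%nat -> (0 < q)%nat -> rel_prime (Z.of_nat p) (Z.of_nat q) ->
  (forall kl, b kl = true <-> A (sigma_pt p q kl)) ->
  is_card (fun y => Sigma (Z.of_nat p) (Z.of_nat q) y /\ A y)
    (length (filter b (inner_box p q))).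
Proof.
intros Hp Hq Hc Hb.
exists (map (sigma_pt p q) (filter b (inner_box p q))); split; [|split].
- apply Injective_map_NoDup_in; [|apply NoDup_filter, NoDup_inner_box].
  intros kl kl'; rewrite !filter_In, !in_inner_box; intros [H _] [H' _] E.
  rewrite !sigma_pt_numer in E by auto.
  apply (numer_inj_mod p q); auto; try (rewrite in_box; lia).
  assert (E' : INR (numer p q kl) = INR (numer p q kl')).
  { apply Rmult_eq_reg_r with (/ INR (p * q)); [exact E|].
    apply Rinv_neq_0_compat, not_0_INR; nia. }
  apply INR_eq in E'; rewrite E'; exists 0%Z; lia.
- intros y; rewrite in_map_iff; split.
  + intros [[k l] [<- H]]; apply filter_In in H; destruct H as [H HA].
    rewrite in_inner_box in H; simpl in H; split; [|apply Hb; exact HA].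
    exists (Z.of_nat k), (Z.of_nat l); repeat split; try lia.
    unfold sigma_pt; simpl; rewrite !INR_IZR_INZ; reflexivity.
  + intros [[k [l [Hk [Hl E]]]] HA].
    assert (Ey : sigma_pt p q (Z.to_nat k, Z.to_nat l) = y).
    { unfold sigma_pt; simpl; rewrite !INR_IZR_INZ, !Z2Nat.id by lia; auto. }
    exists (Z.to_nat k, Z.to_nat l); split; [exact Ey|].
    rewrite filter_In, in_inner_box; simpl; split; [lia|].
    apply Hb; rewrite Ey; exact HA.
- apply length_map.
Qed.

Definition window (x y : R) : bool :=
  if Rlt_dec x y then if Rlt_dec y (x + 1) then true else false else false.

Lemma window_spec (x y : R) : window x y = true <-> x < y < x + 1.
Proof.
unfold window; destruct (Rlt_dec x y); [destruct (Rlt_dec y (x + 1))|];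
  split; intros; try easy; tauto.
Qed.

(** The share of one point [y] in [s]: 1 from the size of [Sigma], and -2 more if [y] is in the
    window. *)
Definition wsign (x y : R) : C := if window x y then (- RtoC 1)%C else RtoC 1.

Lemma s_Csum (p q : nat) (x : R) :
  (0 < p)%nat -> (0 < q)%nat -> rel_prime (Z.of_nat p) (Z.of_nat q) ->
  RtoC (IZR (s (Z.of_nat p) (Z.of_nat q) x))
  = Csum (inner_box p q) (fun kl => wsign x (sigma_pt p q kl)).
Proof.
intros Hp Hq Hc; unfold s.
rewrite (card_eq _ _ (is_card_Sigma_filter p q (fun y => x < y < x + 1)
  (fun kl => window x (sigma_pt p q kl)) Hp Hq Hc (fun kl => window_spec x _))).
assert (Hall : is_card (Sigma (Z.of_nat p) (Z.of_nat q)) (length (inner_box p q))).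
{ destruct (is_card_Sigma_filter p q (fun _ => True) (fun _ => true) Hp Hq Hc)
    as [l [Nl [Al El]]]; [tauto|].
  exists l; split; [exact Nl|split].
  - intros y; rewrite Al; tauto.
  - rewrite El; f_equal; clear; induction (inner_box p q); simpl; congruence. }
rewrite (card_eq _ _ Hall); clear Hall.
induction (inner_box p q) as [|kl l IH]; [reflexivity|].
simpl Csum; rewrite <- IH; unfold wsign; simpl filter.
destruct (window x (sigma_pt p q kl)); simpl length;
  rewrite !Nat2Z.inj_succ, <- RtoC_opp || rewrite !Nat2Z.inj_succ;
  rewrite <- RtoC_plus; f_equal; rewrite <- ?opp_IZR, <- plus_IZR; f_equal; lia.
Qed.

(** * Integrals of exponentials against step functions *)

(* [ring] and [field] need the carrier of [C_R_NormedModule] spelled [C]. *)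
Ltac eq_in_C :=
  change (plus (G := C_R_NormedModule)) with Cplus;
  lazymatch goal with |- @eq _ ?x ?y => change (@eq C x y) end.

Lemma is_RInt_Cmult (f : R -> C) (a b : R) (c l : C) :
  is_RInt (V := C_R_NormedModule) f a b l ->
  is_RInt (V := C_R_NormedModule) (fun x => (c * f x)%C) a b (c * l)%C.
Proof.
intros H.
assert (H1 := is_RInt_fct_extend_fst (U := R_NormedModule) (V := R_NormedModule) f a b l H).
assert (H2 := is_RInt_fct_extend_snd (U := R_NormedModule) (V := R_NormedModule) f a b l H).
destruct c as [c d].
apply (is_RInt_fct_extend_pair (U := R_NormedModule) (V := R_NormedModule)); simpl.
- apply (is_RInt_minus (V := R_NormedModule)); apply (is_RInt_scal (V := R_NormedModule)); assumption.
- apply (is_RInt_plus (V := R_NormedModule)); apply (is_RInt_scal (V := R_NormedModule)); assumption.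
Qed.

Lemma Cexp_mult_RtoC (u v x : R) :
  Cexp ((u, v) * RtoC x) = (exp (u * x) * cos (v * x), exp (u * x) * sin (v * x)).
Proof.
unfold Cexp; simpl.
replace (u * x - v * 0) with (u * x) by ring.
replace (u * 0 + v * x) with (v * x) by ring.
apply injective_projections; simpl; ring.
Qed.

Lemma is_RInt_Cexp (c : C) (a b : R) :
  c <> 0 ->
  is_RInt (V := C_R_NormedModule) (fun x => Cexp (c * RtoC x)) a b
    ((Cexp (c * RtoC b) - Cexp (c * RtoC a)) / c)%C.
Proof.
intros Hc.
(* The integrand times [c] is an exact derivative, so the fundamental theorem applies to its real
   and imaginary parts; division by [c] comes last. *)
assert (H : is_RInt (V := C_R_NormedModule) (fun x => (c * Cexp (c * RtoC x))%C) a b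
    (Cexp (c * RtoC b) - Cexp (c * RtoC a))%C).
{ destruct c as [u v].
  apply (is_RInt_fct_extend_pair (U := R_NormedModule) (V := R_NormedModule)
    _ a b (fst _) (snd _)).
  - apply (is_RInt_ext (V := R_NormedModule)
      (fun x => exp (u * x) * (u * cos (v * x) - v * sin (v * x)))).
    { intros x _; rewrite Cexp_mult_RtoC; simpl; ring. }
    replace (fst _) with (minus (exp (u * b) * cos (v * b)) (exp (u * a) * cos (v * a))).
    + apply (is_RInt_derive (V := R_CompleteNormedModule)
        (fun x => exp (u * x) * cos (v * x))).
      * intros x _; auto_derive; auto; ring.
      * intros x _; apply (ex_derive_continuous (V := R_NormedModule)); auto_derive; auto.
    + rewrite !Cexp_mult_RtoC; reflexivity.
  - apply (is_RInt_ext (V := R_NormedModule)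
      (fun x => exp (u * x) * (u * sin (v * x) + v * cos (v * x)))).
    { intros x _; rewrite Cexp_mult_RtoC; simpl; ring. }
    replace (snd _) with (minus (exp (u * b) * sin (v * b)) (exp (u * a) * sin (v * a))).
    + apply (is_RInt_derive (V := R_CompleteNormedModule)
        (fun x => exp (u * x) * sin (v * x))).
      * intros x _; auto_derive; auto; ring.
      * intros x _; apply (ex_derive_continuous (V := R_NormedModule)); auto_derive; auto.
    + rewrite !Cexp_mult_RtoC; reflexivity. }
apply (is_RInt_Cmult _ a b (/ c)) in H.
replace (_ / c)%C with (/ c * (Cexp (c * RtoC b) - Cexp (c * RtoC a)))%C
  by (field; exact Hc).
revert H; apply (is_RInt_ext (V := C_R_NormedModule)); intros x _.
eq_in_C; field; exact Hc.
Qed.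

Lemma is_RInt_Csum {A : Type} (l : list A) (f : A -> R -> C) (v : A -> C) (a b : R) :
  (forall i, In i l -> is_RInt (V := C_R_NormedModule) (f i) a b (v i)) ->
  is_RInt (V := C_R_NormedModule) (fun x => Csum l (fun i => f i x)) a b (Csum l v).
Proof.
induction l as [|i l IH]; simpl; intros H.
- assert (E := is_RInt_const (V := C_R_NormedModule) a b zero).
  assert (Z : scal (V := C_R_NormedModule) (b - a) zero = zero) by apply scal_zero_r.
  exact (eq_ind _ (is_RInt (V := C_R_NormedModule) (fun _ => zero) a b) E _ Z).
- apply (is_RInt_plus (V := C_R_NormedModule)); auto.
Qed.

(** The values of [f] at 0, [t] and 1 are left free, so the open ends of the window need no care. *)
Lemma is_RInt_Cexp_step (c e1 e2 : C) (f : R -> C) (t : R) :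
  c <> 0 -> 0 <= t <= 1 ->
  (forall x, 0 < x < t -> f x = e1) -> (forall x, t < x < 1 -> f x = e2) ->
  is_RInt (V := C_R_NormedModule) (fun x => (Cexp (c * RtoC x) * f x)%C) 0 1
    ((e1 * (Cexp (c * RtoC t) - 1) + e2 * (Cexp c - Cexp (c * RtoC t))) / c)%C.
Proof.
intros Hc Ht H1 H2.
replace (_ / c)%C with
  (plus (G := C_R_NormedModule) (e1 * ((Cexp (c * RtoC t) - Cexp (c * RtoC 0)) / c))%C
    (e2 * ((Cexp (c * RtoC 1) - Cexp (c * RtoC t)) / c))%C).
- apply (is_RInt_Chasles (V := C_R_NormedModule) _ 0 t 1).
  + apply (is_RInt_ext (V := C_R_NormedModule) (fun x => (e1 * Cexp (c * RtoC x))%C)).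
    * rewrite Rmin_left, Rmax_right by lra; intros x Hx; rewrite H1 by exact Hx; apply Cmult_comm.
    * apply is_RInt_Cmult, is_RInt_Cexp; exact Hc.
  + apply (is_RInt_ext (V := C_R_NormedModule) (fun x => (e2 * Cexp (c * RtoC x))%C)).
    * rewrite Rmin_left, Rmax_right by lra; intros x Hx; rewrite H2 by exact Hx; apply Cmult_comm.
    * apply is_RInt_Cmult, is_RInt_Cexp; exact Hc.
- eq_in_C.
  rewrite Cmult_0_r, Cmult_1_r, Cexp_0; field; exact Hc.
Qed.

Lemma window_false (x y : R) : ~ (x < y < x + 1) -> window x y = false.
Proof.
intros H; destruct (window x y) eqn:E; auto; apply window_spec in E; tauto.
Qed.

(** As [x] runs from 0 to 1, a point [t] below 1 leaves the window when [x] passes [t], while a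
    point [t + 1] enters it there. The sign thus jumps once, up or down. *)
Lemma is_RInt_Cexp_wsign (c : C) (p q : nat) (kl : nat * nat) :
  (0 < p)%nat -> (0 < q)%nat -> c <> 0 -> In kl (inner_box p q) ->
  is_RInt (V := C_R_NormedModule)
    (fun x => (Cexp (c * RtoC x) * wsign x (sigma_pt p q kl))%C) 0 1
    (/ c * jump_term (Cexp (c / RtoC (INR (p * q)))) p q kl)%C.
Proof.
intros Hp Hq Hc Hkl; rewrite in_inner_box in Hkl.
assert (HN : 0 < INR (p * q)) by (apply lt_0_INR; nia).
assert (HNC : RtoC (INR (p * q)) <> 0).
{ intros E; apply (f_equal fst) in E; simpl in E; lra. }
assert (Hpow : forall n, (Cexp (c / RtoC (INR (p * q))) ^ n)%C
                         = Cexp (c * RtoC (INR n / INR (p * q)))).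
{ intros n; rewrite Cexp_pow, RtoC_div by lra; f_equal; field; exact HNC. }
rewrite sigma_pt_numer by auto.
unfold jump_term, side, low, high.
destruct (Nat.ltb_spec (numer p q kl) (p * q)) as [L|L].
- set (t := INR (numer p q kl) / INR (p * q)).
  assert (Ht : 0 <= t < 1).
  { unfold t; split; [apply Rle_div_r; try lra; rewrite Rmult_0_l; apply pos_INR|].
    apply Rlt_div_l; auto; rewrite Rmult_1_l; apply lt_INR; exact L. }
  match goal with |- is_RInt _ _ _ ?v => replace v with
    ((- (1) * (Cexp (c * RtoC t) - 1) + 1 * (Cexp c - Cexp (c * RtoC t))) / c)%C end.
  + apply is_RInt_Cexp_step; auto; [lra| |]; intros x Hx; unfold wsign.
    * rewrite (proj2 (window_spec x t)) by lra; reflexivity.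
    * rewrite window_false by lra; reflexivity.
  + rewrite !Hpow; fold t.
    replace (INR (p * q) / INR (p * q)) with 1 by (field; lra).
    rewrite (Cmult_1_r c); eq_in_C; field; exact Hc.
- set (t := INR (numer p q kl - p * q) / INR (p * q)).
  assert (Et : INR (numer p q kl) / INR (p * q) = t + 1).
  { unfold t; rewrite minus_INR by exact L; field; lra. }
  rewrite Et.
  assert (Ht : 0 <= t <= 1).
  { unfold t; split; [apply Rle_div_r; try lra; rewrite Rmult_0_l; apply pos_INR|].
    apply Rle_div_l; auto; rewrite Rmult_1_l; apply le_INR; unfold numer; nia. }
  match goal with |- is_RInt _ _ _ ?v => replace v with
    ((1 * (Cexp (c * RtoC t) - 1) + - (1) * (Cexp c - Cexp (c * RtoC t))) / c)%C end.
  + apply is_RInt_Cexp_step; auto; intros x Hx; unfold wsign.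
    * rewrite window_false by lra; reflexivity.
    * rewrite (proj2 (window_spec x (t + 1))) by lra; reflexivity.
  + rewrite !Hpow; fold t.
    replace (INR (p * q) / INR (p * q)) with 1 by (field; lra).
    rewrite (Cmult_1_r c); eq_in_C; field; exact Hc.
Qed.

Lemma is_RInt_Cexp_s (c : C) (p q : nat) :
  (0 < p)%nat -> (0 < q)%nat -> rel_prime (Z.of_nat p) (Z.of_nat q) -> c <> 0 ->
  is_RInt (V := C_R_NormedModule)
    (fun x => (Cexp (c * RtoC x) * RtoC (IZR (s (Z.of_nat p) (Z.of_nat q) x)))%C) 0 1
    (/ c * Csum (inner_box p q) (jump_term (Cexp (c / RtoC (INR (p * q)))) p q))%C.
Proof.
intros Hp Hq Hpq Hc; rewrite <- Csum_mult_l.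
apply (is_RInt_ext (V := C_R_NormedModule) (fun x => Csum (inner_box p q)
  (fun kl => (Cexp (c * RtoC x) * wsign x (sigma_pt p q kl))%C))).
- intros x _; rewrite s_Csum, Csum_mult_l by auto; reflexivity.
- apply is_RInt_Csum; intros kl Hkl; apply is_RInt_Cexp_wsign; auto.
Qed.

(** * From [r = 1] to general [r] *)

Lemma is_RInt_Cexp_s_r (c : C) (p q : Z) (r : nat) (l : C) :
  (0 < r)%nat ->
  is_RInt (V := C_R_NormedModule)
    (fun x => (Cexp (c * RtoC x) * RtoC (IZR (s p q x)))%C) 0 1 l ->
  is_RInt (V := C_R_NormedModule)
    (fun x => (Cexp (RtoC (INR r) * c * RtoC x)
      * RtoC (IZR (s_r p q (Z.of_nat r) x)))%C) 0 1
    (/ RtoC (INR r) * l * Csum (seq 0 r) (Cpow (Cexp c)))%C.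
Proof.
intros Hr Hl; apply lt_0_INR in Hr.
set (f := fun x => (Cexp (RtoC (INR r) * c * RtoC x)
      * RtoC (IZR (s_r p q (Z.of_nat r) x)))%C).
assert (HrC : RtoC (INR r) <> 0).
{ intros E; apply (f_equal fst) in E; simpl in E; lra. }
(* Between [j / r] and [(j + 1) / r] the fractional part of [r x] is [r x - j]. This substitution
   brings out the Jacobian [1 / r] and the factor [Cexp c ^ j]. *)
assert (Hpiece : forall j : nat, is_RInt (V := C_R_NormedModule) f
  (INR j / INR r) (INR (S j) / INR r) (/ RtoC (INR r) * l * Cexp c ^ j)%C).
{ intros j.
  replace (/ RtoC (INR r) * l * Cexp c ^ j)%C
    with (/ RtoC (INR r) * Cexp c ^ j * l)%C by ring.
  apply (is_RInt_ext (V := C_R_NormedModule) (fun x => (/ RtoC (INR r) * Cexp c ^ j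
    * scal (V := C_R_NormedModule) (INR r) (Cexp (c * RtoC (INR r * x + - INR j))
      * RtoC (IZR (s p q (INR r * x + - INR j)))))%C)).
  - assert (Hj : INR j / INR r <= INR (S j) / INR r).
    { apply Rmult_le_compat_r; [|rewrite S_INR; lra].
      apply Rlt_le, Rinv_0_lt_compat; exact Hr. }
    rewrite Rmin_left, Rmax_right by exact Hj.
    intros x [Hx1 Hx2]; unfold f.
    apply Rlt_div_l in Hx1; [|exact Hr]; apply Rlt_div_r in Hx2; [|exact Hr].
    rewrite S_INR in Hx2; rewrite scal_R_Cmult, Cexp_pow.
    unfold s_r; rewrite <- INR_IZR_INZ.
    assert (Hfp : frac_part (INR r * x) = INR r * x + - INR j).
    { symmetry; apply (Int_part_frac_part_spec _ (Z.of_nat j)); [lra|].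
      rewrite <- INR_IZR_INZ; ring. }
    rewrite Hfp.
    replace (RtoC (INR r) * c * RtoC x)%C
      with (RtoC (INR j) * c + c * RtoC (INR r * x + - INR j))%C
      by (rewrite RtoC_plus, RtoC_mult, RtoC_opp; ring).
    rewrite Cexp_plus; eq_in_C; field; exact HrC.
  - apply is_RInt_Cmult.
    apply (is_RInt_comp_lin (V := C_R_NormedModule)
      (fun x => (Cexp (c * RtoC x) * RtoC (IZR (s p q x)))%C) (INR r) (- INR j)).
    replace (INR r * (INR j / INR r) + - INR j) with 0 by (field; lra).
    replace (INR r * (INR (S j) / INR r) + - INR j) with 1
      by (rewrite S_INR; field; lra).
    exact Hl. }
(* The upper limit is written as [r / r] to be reached by induction on [n] in [n / r]. *)
replace 1 with (INR r / INR r) by (field; lra).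
assert (Hsum : forall n : nat, is_RInt (V := C_R_NormedModule) f 0 (INR n / INR r)
  (/ RtoC (INR r) * l * Csum (seq 0 n) (Cpow (Cexp c)))%C).
{ induction n as [|n IH].
  - simpl; unfold Rdiv; rewrite Rmult_0_l, Cmult_0_r.
    apply (is_RInt_point (V := C_R_NormedModule)).
  - match goal with |- is_RInt _ _ _ ?v => replace v with (plus (G := C_R_NormedModule)
      (/ RtoC (INR r) * l * Csum (seq 0 n) (Cpow (Cexp c)))%C
      (/ RtoC (INR r) * l * Cexp c ^ n)%C) end.
    + apply (is_RInt_Chasles (V := C_R_NormedModule) f 0 (INR n / INR r)); auto.
    + eq_in_C.
      rewrite seq_S, Csum_app; simpl Csum; ring. }
apply Hsum.
Qed.

(** * Assembly of the cotangent formula *)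

Theorem theorem2p8 (p q r : Z) (hp : (0 < p)%Z) (hq : (0 < q)%Z)
    (hpq : rel_prime p q) (hr : (1 <= r)%Z) (beta : C)
    (hbeta : ~ exists m : Z, beta = RtoC (IZR m) /\ (r | m)%Z) :
  is_RInt (V := C_R_NormedModule)
    (fun x : R =>
       (Cexp (RtoC PI * Ci * beta * RtoC x) * RtoC (IZR (s_r p q r x)))%C)
    0%R 1%R
    (RtoC 2 * Cexp (RtoC PI * Ci * beta / RtoC 2)
       * Csin (RtoC PI * beta / RtoC 2) / (RtoC PI * beta)
     * n_r p q r (RtoC PI * beta / RtoC 2))%C.
Proof.
assert (RtoC_neq0 : forall a : R, a <> 0 -> RtoC a <> 0).
{ intros a Ha E; apply Ha, RtoC_inj; exact E. }
assert (Hi := Ci_nz); assert (HPI := RtoC_neq0 PI PI_neq0).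
assert (H2 : RtoC 2 <> 0) by (apply RtoC_neq0; lra).
assert (Hb0 : beta <> 0).
{ intros E; apply hbeta; exists 0%Z; split; [exact E|apply Z.divide_0_r]. }
assert (Hp0 : RtoC (IZR p) <> 0) by (apply RtoC_neq0, not_0_IZR; lia).
assert (Hq0 : RtoC (IZR q) <> 0) by (apply RtoC_neq0, not_0_IZR; lia).
assert (Hr0 : RtoC (IZR r) <> 0) by (apply RtoC_neq0, not_0_IZR; lia).
set (c := (RtoC PI * Ci * beta / RtoC (IZR r))%C).
assert (Hc0 : c <> 0).
{ intros E; apply (Cmult_neq_0 _ _ (Cmult_neq_0 _ _ HPI Hi) Hb0).
  replace (RtoC PI * Ci * beta)%C with (c * RtoC (IZR r))%C by (unfold c; field; auto).
  rewrite E; apply Cmult_0_l. }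
(* Otherwise [c = 2 k PI i], so [beta = 2 k r] would be a multiple of [r]. *)
assert (HU : Cexp c <> 1).
{ intros E; apply Cexp_eq_1 in E; destruct E as [k Hk].
  apply hbeta; exists (2 * k * r)%Z; split; [|exists (2 * k)%Z; ring].
  rewrite !mult_IZR, RtoC_mult, <- mult_IZR.
  replace beta with (c * RtoC (IZR r) / (RtoC PI * Ci))%C
    by (unfold c; field; auto).
  rewrite Hk, !mult_IZR, RtoC_mult; field; auto. }
set (u := Cexp (c / RtoC (IZR (p * q)))).
set (P := Z.to_nat p); set (Q := Z.to_nat q); set (R := Z.to_nat r).
assert (EP : Z.of_nat P = p) by (apply Z2Nat.id; lia).
assert (EQ : Z.of_nat Q = q) by (apply Z2Nat.id; lia).
assert (ER : Z.of_nat R = r) by (apply Z2Nat.id; lia).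
assert (IP : INR P = IZR p) by (rewrite INR_IZR_INZ, EP; reflexivity).
assert (IQ : INR Q = IZR q) by (rewrite INR_IZR_INZ, EQ; reflexivity).
assert (IR : INR R = IZR r) by (rewrite INR_IZR_INZ, ER; reflexivity).
assert (Upow : forall n, (u ^ n)%C = Cexp (c * (RtoC (INR n) / RtoC (IZR (p * q))))).
{ intros n; unfold u; rewrite Cexp_pow; f_equal.
  rewrite mult_IZR, RtoC_mult; field; auto. }
assert (UPQ : (u ^ (P * Q))%C = Cexp c).
{ rewrite Upow, mult_INR, IP, IQ, mult_IZR; f_equal; rewrite RtoC_mult; field; auto. }
assert (UP : (u ^ P)%C = Cexp (c / RtoC (IZR q))).
{ rewrite Upow, IP, mult_IZR; f_equal; rewrite RtoC_mult; field; auto. }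
assert (UQ : (u ^ Q)%C = Cexp (c / RtoC (IZR p))).
{ rewrite Upow, IQ, mult_IZR; f_equal; rewrite RtoC_mult; field; auto. }
assert (HUP : (u ^ P)%C <> 1).
{ intros E; apply HU; rewrite <- UPQ, Cpow_mult_r, E; apply Cpow_1_l. }
assert (HUQ : (u ^ Q)%C <> 1).
{ intros E; apply HU; rewrite <- UPQ, Nat.mul_comm, Cpow_mult_r, E; apply Cpow_1_l. }
assert (Hu : u <> 1).
{ intros E; apply HU; rewrite <- UPQ, E; apply Cpow_1_l. }
assert (Hint := is_RInt_Cexp_s c P Q).
rewrite EP, EQ in Hint.
specialize (Hint ltac:(lia) ltac:(lia) hpq Hc0).
assert (IPQ : INR (P * Q) = IZR (p * q)) by (rewrite mult_INR, IP, IQ, mult_IZR; reflexivity).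
rewrite IPQ in Hint; fold u in Hint.
rewrite Csum_jump_term in Hint; try lia; try (rewrite UPQ; exact HU);
  [|rewrite EP, EQ; exact hpq].
apply (is_RInt_Cexp_s_r c p q R) in Hint; [|lia].
rewrite ER, IR in Hint.
assert (Ec : (RtoC (IZR r) * c = RtoC PI * Ci * beta)%C) by (unfold c; field; auto).
rewrite Ec in Hint.
assert (Hgeo := Csum_geometric (Cexp c) R).
rewrite Cexp_pow, IR, Ec in Hgeo.
(* The factorisation [E * E - 1 = E * (E - / E)] will produce the exponential and the sine of the
   prefactor. *)
set (E := Cexp (RtoC PI * Ci * beta / RtoC 2)).
assert (HE : E <> 0) by apply Cexp_neq_0.
assert (EE : Cexp (RtoC PI * Ci * beta) = (E * E)%C).
{ unfold E; rewrite <- Cexp_plus; f_equal; field; auto. }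
assert (Esin : Csin (RtoC PI * beta / RtoC 2) = ((E - / E) / (RtoC 2 * Ci))%C).
{ unfold Csin; rewrite Cexp_opp.
  replace (Ci * (RtoC PI * beta / RtoC 2))%C with (RtoC PI * Ci * beta / RtoC 2)%C
    by (field; auto); reflexivity. }
(* For [d] equal to [p q r], [r], [p r], [q r] the exponential [w] is [u], [Cexp c], [u ^ Q],
   [u ^ P] respectively. *)
assert (Ecot : forall d w : C, d <> 0 -> Cexp (c * (RtoC (IZR r) / d)) = w -> w <> 1 ->
  Ccot (RtoC PI * beta / RtoC 2 / d) = (Ci * (w + 1) / (w - 1))%C).
{ intros d w Hd Hw Hw1; rewrite <- Hw in *.
  replace (c * (RtoC (IZR r) / d))%C with (2 * Ci * (RtoC PI * beta / RtoC 2 / d))%C in *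
    by (unfold c; field; auto).
  apply Ccot_Cexp; exact Hw1. }
unfold n_r.
rewrite (Ecot (RtoC (IZR (p * q * r))) u), (Ecot (RtoC (IZR r)) (Cexp c)),
  (Ecot (RtoC (IZR (p * r))) (u ^ Q)%C), (Ecot (RtoC (IZR (q * r))) (u ^ P)%C); auto;
  try (apply RtoC_neq0, not_0_IZR; nia).
2: { rewrite UP, mult_IZR, RtoC_mult; f_equal; field; auto. }
2: { rewrite UQ, mult_IZR, RtoC_mult; f_equal; field; auto. }
2: { f_equal; field; auto. }
2: { unfold u; rewrite !mult_IZR, !RtoC_mult; f_equal; field; auto. }
rewrite Esin.
match type of Hint with is_RInt _ _ _ ?v =>
  match goal with |- is_RInt _ _ _ ?w => replace w with v; [exact Hint|] end end.
eq_in_C; rewrite UPQ.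
set (S := Csum _ _) in *.
assert (HU1 : (Cexp c - 1)%C <> 0) by (apply Cminus_eq_contra; exact HU).
assert (HUP1 : (u ^ P - 1)%C <> 0) by (apply Cminus_eq_contra; exact HUP).
assert (HUQ1 : (u ^ Q - 1)%C <> 0) by (apply Cminus_eq_contra; exact HUQ).
assert (Hu1 : (u - 1)%C <> 0) by (apply Cminus_eq_contra; exact Hu).
(* This denominator cancels the factor [u ^ (P * Q) - 1] coming from [Csum_jump_term]. *)
assert (ES : S = ((E * E - 1) / (Cexp c - 1))%C) by (rewrite <- EE, <- Hgeo; field; auto).
assert (Einv : (/ c = RtoC (IZR r) / (RtoC PI * Ci * beta))%C)
  by (unfold c; field; auto).
rewrite ES, Einv.
assert (Ci2 : (Ci * Ci = - (1))%C) by (apply injective_projections; simpl; ring).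
set (U := Cexp c) in *; set (V := (u ^ P)%C) in *; set (W := (u ^ Q)%C) in *.
clearbody U V W u E.
(* Each product of two cotangents carries [Ci * Ci], which reverses the difference in [n_r]. With
   the factor [- (Ci * Ci)], equal to 1, made explicit, the comparison with the cotangent side is
   rational in [Ci]. *)
transitivity (- (Ci * Ci) * ((E * E - 1) / (RtoC PI * Ci * beta)
  * ((V + 1) / (V - 1) * ((W + 1) / (W - 1))
     - (u + 1) / (u - 1) * ((U + 1) / (U - 1)))))%C.
- rewrite Ci2; field; repeat split; auto.
- field; repeat split; auto.
Qed.
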